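(* Let $\mathbb{X}$ and $\mathbb{Y}$ be inner product categories, and let $(F,\gamma):\mathbb{X}\to\mathbb{Y}$ be an involutive functor. Then $(F,\gamma)$ preserves the inner product if and only if it is a unitary functor.
   Context: Composition is written in diagrammatic order: $fg$ means first $f$, then $g$. An involutive category $(\mathbb{X},(-)^\dagger,\iota)$ is a category $\mathbb{X}$ with a functor $(-)^\dagger:\mathbb{X}^{\mathrm{op}}\to\mathbb{X}$ and a natural isomorphism $\iota_X:X\to X^{\dagger\dagger}$ such that $\iota_{X^\dagger}(\iota_X)^\dagger=1_{X^\dagger}$. An inner product category is an involutive category with a combinator assigning to each pair $f:A\to X$, $g:B\to X$ a map $\langle f|g\rangle:A\to B^\dagger$ satisfying the axioms below, where for $h:X\to A$, $k:X\to B$ the dual inner product is $\langle h|k\rangle^\iota := \iota_{A^\dagger}\,\langle k^\dagger|h^\dagger\rangle^\dagger\,\iota_B^{-1}:A^\dagger\to B$: [IP.1] $\langle hf|kg\rangle = h\langle f|g\rangle k^\dagger$ for $f:A\to X$, $g:B\to X$, $h:Y\to A$, $k:Z\to B$; [IP.2](a) $\iota_A\langle f^\dagger|g^\dagger\rangle^\iota=\langle f|g\rangle$ and (b) $\iota_B\langle f|g\rangle^\dagger=\langle g|f\rangle$ for $f:A\to X$, $g:B\to X$; [IP.3] $\langle f|g\rangle\langle h|k\rangle^\iota = fk$ for $f:A\to X$, $g:B\to X$, $h,k:X\to B$ with $hg=1_X$; [IP.4] $\langle f|g\rangle^\iota\langle h|k\rangle=(kf)^\dagger$ for $f:A\to Z$,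 $g:A\to X$, $h,k:X\to A$ with $gh=1_A$. An inner product category is a unitary category with unitary structure maps $\varphi_A:=\langle 1_A|1_A\rangle:A\to A^\dagger$ (these are isomorphisms with $\varphi_{A^\dagger}=(\varphi_A^{-1})^\dagger$ and $\varphi_A\varphi_{A^\dagger}=\iota_A$). An involutive functor $(F,\gamma):(\mathbb{X},(-)^\dagger,\iota)\to(\mathbb{Y},(-)^\ddagger,\iota')$ is a functor $F$ with a natural isomorphism $\gamma_X:F(X^\dagger)\to F(X)^\ddagger$ such that $F(\iota_X)\gamma_{X^\dagger}=\iota'_{F(X)}(\gamma_X)^\ddagger$. It preserves the inner product if $\langle F(f)|F(g)\rangle=F(\langle f|g\rangle)\gamma_A$ for all parallel maps $f,g:A\to X$ in $\mathbb{X}$. It is a unitary functor if $F(\varphi_X)\gamma_X=\varphi_{F(X)}$ for all $X\in\mathbb{X}$. *)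

(* Defs.v *)
Set Implicit Arguments.
Unset Strict Implicit.
Unset Printing Implicit Defensive.

Declare Scope cat_scope.
Delimit Scope cat_scope with cat.
Local Open Scope cat_scope.

(* Composition is diagrammatic: [f ;; g] is first [f], then [g]. *)
Record Category := {
  Obj :> Type;
  hom : Obj -> Obj -> Type;
  idm : forall A, hom A A;
  comp : forall A B C, hom A B -> hom B C -> hom A C;
  comp1m : forall A B (f : hom A B), comp (idm A) f = f;
  compm1 : forall A B (f : hom A B), comp f (idm B) = f;
  compA : forall A B C D (f : hom A B) (g : hom B C) (h : hom C D),
    comp f (comp g h) = comp (comp f g) h
}.
Arguments hom {_} _ _.
Arguments idm {_} A.
Arguments comp {_ A B C} f g.
Notation "f ;; g" := (comp f g) (at level 50, left associativity) : cat_scope.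

Definition op (C : Category) : Category := {|
  Obj := Obj C;
  hom A B := @hom C B A;
  idm A := idm A;
  comp A B D f g := @comp C D B A g f;
  comp1m A B f := compm1 f;
  compm1 A B f := comp1m f;
  compA A B D E f g h := eq_sym (compA h g f)
|}.

Record Functor (C D : Category) := {
  fobj :> Obj C -> Obj D;
  fmap : forall A B : Obj C, hom A B -> hom (fobj A) (fobj B);
  fmap1 : forall A, fmap (idm A) = idm (fobj A);
  fmapM : forall A B E (f : hom A B) (g : hom B E),
    fmap (f ;; g) = fmap f ;; fmap g
}.
Arguments fmap {C D} F {A B} f : rename.

Definition functor_id (C : Category) : Functor C C := {|
  fobj A := A;
  fmap A B f := f;
  fmap1 A := eq_refl;
  fmapM A B E f g := eq_refl
|}.

Definition functor_comp (C D E : Category) (F : Functor C D) (G : Functor D E) :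
  Functor C E.
Proof.
refine {| fobj A := G (F A); fmap A B f := fmap G (fmap F f) |}.
- intros A. rewrite !fmap1. reflexivity.
- intros A B H f g. rewrite !fmapM. reflexivity.
Defined.

Definition functor_op (C D : Category) (F : Functor C D) :
  Functor (op C) (op D).
Proof.
refine (@Build_Functor (op C) (op D) (fun A => F A)
  (fun A B f => @fmap C D F B A f) _ _).
- intros A. exact (fmap1 F A).
- intros A B E f g. exact (fmapM F g f).
Defined.

(* [op (op C)] is not convertible to [C], so a contravariant functor is
   transposed directly rather than through [functor_op]. *)
Definition functor_transp (C D : Category) (F : Functor (op C) D) :
  Functor C (op D).
Proof.
refine (@Build_Functor C (op D) (fun A => F A)
  (fun A B f => @fmap (op C) D F B A f) _ _).
- intros A. exact (fmap1 F A).
- intros A B E f g. exact (@fmapM _ _ F E B A g f).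
Defined.

Record NatIso (C D : Category) (F G : Functor C D) := {
  nat_map :> forall A : Obj C, @hom D (F A) (G A);
  nat_inv : forall A : Obj C, @hom D (G A) (F A);
  nat_mapK : forall A, nat_map A ;; nat_inv A = idm (F A);
  nat_invK : forall A, nat_inv A ;; nat_map A = idm (G A);
  naturality : forall (A B : Obj C) (f : hom A B),
    fmap F f ;; nat_map B = nat_map A ;; fmap G f
}.

Record InvolutiveCategory := {
  inv_cat :> Category;
  dagger : Functor (op inv_cat) inv_cat;
  iota : NatIso (functor_id inv_cat)
                (functor_comp (functor_transp dagger) dagger);
  iota_dagger : forall A : Obj inv_cat,
    iota (dagger A) ;; @fmap _ _ dagger (dagger (dagger A)) A (iota A)
    = idm (dagger A)
}.

Definition dago (X : InvolutiveCategory) (A : Obj X) : Obj X := dagger X A.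

Definition dag (X : InvolutiveCategory) (A B : Obj X) (f : hom A B) :
  hom (dago B) (dago A) := @fmap (op X) X (dagger X) B A f.

Definition io (X : InvolutiveCategory) (A : Obj X) : hom A (dago (dago A)) :=
  iota X A.

Definition io_inv (X : InvolutiveCategory) (A : Obj X) :
  hom (dago (dago A)) A := nat_inv (iota X) A.

Definition ip_combinator (X : InvolutiveCategory) : Type :=
  forall A B Z : Obj X, hom A Z -> hom B Z -> hom A (dago B).

Definition dual_ip (X : InvolutiveCategory) (ip : ip_combinator X)
  (A B Z : Obj X) (h : hom Z A) (k : hom Z B) : hom (dago A) B :=
  io (dago A) ;; dag (ip _ _ _ (dag k) (dag h)) ;; io_inv B.

Record InnerProductCategory := {
  ip_cat :> InvolutiveCategory;
  ip : ip_combinator ip_cat;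
  IP1 : forall (A B Y Z W : Obj ip_cat)
    (f : hom A W) (g : hom B W) (h : hom Y A) (k : hom Z B),
    ip (h ;; f) (k ;; g) = h ;; ip f g ;; dag k;
  IP2a : forall (A B W : Obj ip_cat) (f : hom A W) (g : hom B W),
    io A ;; dual_ip ip (dag f) (dag g) = ip f g;
  IP2b : forall (A B W : Obj ip_cat) (f : hom A W) (g : hom B W),
    io B ;; dag (ip f g) = ip g f;
  IP3 : forall (A B W : Obj ip_cat)
    (f : hom A W) (g : hom B W) (h k : hom W B),
    h ;; g = idm W -> ip f g ;; dual_ip ip h k = f ;; k;
  IP4 : forall (A W Z : Obj ip_cat)
    (f : hom A Z) (g : hom A W) (h k : hom W A),
    g ;; h = idm A -> dual_ip ip f g ;; ip h k = dag (k ;; f)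
}.
Arguments ip {_ A B Z} f g : rename.

Record UnitaryCategory := {
  un_cat :> InvolutiveCategory;
  phi : forall A : Obj un_cat, hom A (dago A);
  phi_inv : forall A : Obj un_cat, hom (dago A) A;
  phiK : forall A, phi A ;; phi_inv A = idm A;
  phi_invK : forall A, phi_inv A ;; phi A = idm (dago A);
  phi_dag : forall A, phi (dago A) = dag (phi_inv A);
  phi_phi : forall A, phi A ;; phi (dago A) = io A
}.
Arguments phi {_} A.

Lemma dag1 (X : InvolutiveCategory) (A : Obj X) : dag (idm A) = idm (dago A).
Proof. exact (fmap1 (dagger X) A). Qed.

Lemma dagM (X : InvolutiveCategory) (A B E : Obj X)
  (f : hom A B) (g : hom B E) :
  dag (f ;; g) = dag g ;; dag f.
Proof. exact (@fmapM _ _ (dagger X) E B A g f). Qed.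

Definition ip_phi (X : InnerProductCategory) (A : Obj X) :
  hom A (dago A) := ip (idm A) (idm A).

Definition ip_phi_inv (X : InnerProductCategory) (A : Obj X) :
  hom (dago A) A :=
  dual_ip (@ip X) (idm A) (idm A).

Lemma ip_phiK (X : InnerProductCategory) (A : Obj X) :
  ip_phi A ;; ip_phi_inv A = idm A.
Proof.
unfold ip_phi, ip_phi_inv.
rewrite (IP3 (idm A) (idm A) (comp1m (idm A))). apply comp1m.
Qed.

Lemma ip_phi_invK (X : InnerProductCategory) (A : Obj X) :
  ip_phi_inv A ;; ip_phi A = idm (dago A).
Proof.
unfold ip_phi, ip_phi_inv.
rewrite (IP4 (idm A) (idm A) (comp1m (idm A))), comp1m. apply dag1.
Qed.

Lemma ip_phi_phi (X : InnerProductCategory) (A : Obj X) :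
  ip_phi A ;; ip_phi (dago A) = io A.
Proof.
assert (E : io A ;; ip_phi_inv (dago A) = ip_phi A).
{ unfold ip_phi, ip_phi_inv. rewrite <- (IP2a (idm A) (idm A)), dag1.
  reflexivity. }
rewrite <- E, <- compA, ip_phi_invK. apply compm1.
Qed.

Lemma ip_phi_dag (X : InnerProductCategory) (A : Obj X) :
  ip_phi (dago A) = dag (ip_phi_inv A).
Proof.
assert (E : io A ;; dag (ip_phi A) = ip_phi A) by apply IP2b.
assert (E1 : ip_phi (dago A) ;; dag (ip_phi A) = idm (dago A)).
{ rewrite <- ip_phi_phi, <- compA in E.
  rewrite <- (comp1m (_ ;; dag _)), <- ip_phi_invK, <- compA, E.
  reflexivity. }
rewrite <- (compm1 (ip_phi (dago A))), <- dag1, <- (ip_phi_invK A).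
rewrite <- (comp1m (dag (ip_phi_inv A))), <- E1, <- compA, <- dagM.
reflexivity.
Qed.

Definition ip_unitary (X : InnerProductCategory) : UnitaryCategory := {|
  un_cat := X;
  phi := @ip_phi X;
  phi_inv := @ip_phi_inv X;
  phiK := @ip_phiK X;
  phi_invK := @ip_phi_invK X;
  phi_dag := @ip_phi_dag X;
  phi_phi := @ip_phi_phi X
|}.

Record InvolutiveFunctor (X Y : InvolutiveCategory) := {
  inv_functor :> Functor X Y;
  gamma : NatIso (functor_comp (dagger X) inv_functor)
                 (functor_comp (functor_op inv_functor) (dagger Y));
  gamma_iota : forall A : Obj X,
    fmap inv_functor (io A) ;; gamma (dago A)
    = io (inv_functor A)
      ;; @dag Y (inv_functor (dago A)) (dago (inv_functor A)) (gamma A)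
}.

Definition gam (X Y : InvolutiveCategory) (F : InvolutiveFunctor X Y)
  (A : Obj X) : @hom Y (F (dago A)) (dago (F A)) := gamma F A.

Definition preserves_inner_product (X Y : InnerProductCategory)
  (F : InvolutiveFunctor X Y) : Prop :=
  forall (A Z : Obj X) (f g : hom A Z),
    ip (fmap F f) (fmap F g) = fmap F (ip f g) ;; gam F A.

Definition unitary_functor (X Y : UnitaryCategory)
  (F : InvolutiveFunctor X Y) : Prop :=
  forall A : Obj X, fmap F (phi A) ;; gam F A = phi (F A).

(* Main.v *)
(* [IP.1] gives <f|g> = f phi g^dagger, so an inner product is determined by
   the maps phi = <1|1>; naturality of gamma then turns preservation of phi
   into preservation of all inner products. *)
Require Import Defs.

Local Open Scope cat_scope.

(** Since every inner product factors through some [ip_phi Z], preservation need only be tested on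
    pairs of identities, where it is the unitary condition. *)

Lemma ip_phiE (X : InnerProductCategory) (A B Z : Obj X)
  (f : hom A Z) (g : hom B Z) :
  ip f g = f ;; ip_phi Z ;; dag g.
Proof.
unfold ip_phi. rewrite <- IP1, !compm1. reflexivity.
Qed.

(** [gamma] is natural over [op X], where [f] runs from [B] to [A]; hence the swapped objects. *)
Lemma gam_natural (X Y : InvolutiveCategory) (F : InvolutiveFunctor X Y)
  (A B : Obj X) (f : hom A B) :
  fmap F (dag f) ;; gam F A = gam F B ;; dag (fmap F f).
Proof. exact (@naturality _ _ _ _ (gamma F) B A f). Qed.

Theorem lemma4p8 (X Y : InnerProductCategory) (F : InvolutiveFunctor X Y) :
  preserves_inner_product F <->
  @unitary_functor (ip_unitary X) (ip_unitary Y) F.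
Proof.
split.
- intros H A. change (fmap F (ip_phi A) ;; gam F A = ip_phi (F A)).
  (* Preservation is applied to [f = g = idm A]. *)
  unfold ip_phi. rewrite <- (H A A), fmap1. reflexivity.
- intros H A Z f g.
  assert (HZ : fmap F (ip_phi Z) ;; gam F Z = ip_phi (F Z)) by exact (H Z).
  (* Both sides become the composite of [fmap F f], [fmap F (ip_phi Z)], [gam F Z] and
     [dag (fmap F g)]. *)
  rewrite !ip_phiE, !fmapM, <- HZ, <- !compA, gam_natural. reflexivity.
Qed.
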